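(* Let $\Phi: H_n \to H_k$ be a unital quantum channel. Then: (1) $\displaystyle \lim_{N \to \infty} \frac 1 N S_{\min}\left(\Phi^{\otimes N}\right) \geq - \log \gamma (\Phi)$; (2) $C(\Phi) \leq \log k + \log \gamma (\Phi)$.
   Context: $H_n$ is the real vector space of $n\times n$ complex Hermitian matrices with inner product $\langle X,Y\rangle={\rm Tr}(XY)$; $H_{n,0}$ is its subspace of traceless matrices, and $H_{n,+,1}$ the set of density matrices. A quantum channel is a completely positive trace-preserving linear map; $\Phi: H_n\to H_k$ is unital if $\Phi(I_n/n)=I_k/k$. The von Neumann entropy is $S(\sigma)=-{\rm Tr}[\sigma\log\sigma]$ (log in a fixed base, used consistently throughout), and $S_{\min}(\Phi)=\min_{\rho\in H_{n,+,1}} S(\Phi(\rho))$. The Holevo quantity is $\chi(\Phi)=\max\left[S\left(\sum_i p_i\Phi(\rho_i)\right)-\sum_i p_i S(\Phi(\rho_i))\right]$, the maximum over finite ensembles of states $\rho_i$ with probabilities $p_i$, and the classical capacity is $C(\Phi)=\lim_{N\to\infty}\frac1N\chi(\Phi^{\otimes N})$. Fix an orthonormal basis $M_1,\dots,M_{n^2-1}$ of $H_{n,0}$ and define the real symmetric positive semidefinite $(n^2-1)\times(n^2-1)$ matrix $A_\Phi$ by $(A_\Phi)_{i,j}={\rm Tr}[\Phi(M_i)\Phi(M_j)]$; its operator norm (largest eigenvalue) $\|A_\Phi\|_\infty$ does not depend on the choice of basis. Define $\gamma(\Phi)=\frac1k+\left(1-\frac1n\right)\|A_\Phi\|_\infty$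 if $n\geq k\|A_\Phi\|_\infty$, and $\gamma(\Phi)=\|A_\Phi\|_\infty$ if $n<k\|A_\Phi\|_\infty$. *)

(* Defs.v *)
From HB Require Import structures.
From mathcomp Require Import all_boot all_order all_algebra.
From mathcomp Require Import all_classical all_reals all_analysis.
From mathcomp Require Export complex mxtens.

Set Implicit Arguments.
Unset Strict Implicit.
Unset Printing Implicit Defensive.

Import Order.TTheory GRing.Theory Num.Theory.
Import numFieldNormedType.Exports.
Local Open Scope ring_scope.
Local Open Scope classical_set_scope.
Local Open Scope complex_scope.

Section QDefs.
Variable R : realType.
Local Notation C := R[i].

Definition mxadj {m p : nat} (A : 'M[C]_(m, p)) : 'M[C]_(p, m) :=
  (map_mx Num.conj A)^T.

Definition hermitian {n : nat} (A : 'M[C]_n) : Prop := mxadj A = A.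

(* positive semidefinite: Hermitian with nonnegative quadratic form
   (the order on C = R[i] means "real and >= 0") *)
Definition psd {n : nat} (A : 'M[C]_n) : Prop :=
  hermitian A /\ forall v : 'cV[C]_n, 0 <= (mxadj v *m A *m v) 0 0.

Definition density {n : nat} (rho : 'M[C]_n) : Prop :=
  psd rho /\ \tr rho = 1.

(* tensor product F (x) G of two linear maps on matrices, defined on the
   matrix units and extended linearly *)
Definition tens_map {n1 k1 n2 k2 : nat}
  (F : 'M[C]_n1 -> 'M[C]_k1) (G : 'M[C]_n2 -> 'M[C]_k2)
  (X : 'M[C]_(n1 * n2)) : 'M[C]_(k1 * k2) :=
  \sum_(i < n1) \sum_(j < n1) \sum_(a < n2) \sum_(b < n2)
     X (mxtens_index (i, a)) (mxtens_index (j, b))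
       *: (F (delta_mx i j) *t G (delta_mx a b)).

Definition is_channel {n k : nat} (Phi : 'M[C]_n -> 'M[C]_k) : Prop :=
  [/\ forall (a : C) (X Y : 'M[C]_n), Phi (a *: X + Y) = a *: Phi X + Phi Y,
      forall X : 'M[C]_n, \tr (Phi X) = \tr X
    & forall (m : nat) (X : 'M[C]_(m * n)),
        psd X -> psd (tens_map (@id 'M[C]_m) Phi X)].

Definition unital {n k : nat} (Phi : 'M[C]_n -> 'M[C]_k) : Prop :=
  Phi ((n%:R)^-1 *: 1%:M) = (k%:R)^-1 *: 1%:M.

(* dimension n^N, defined so that dpow n N.+1 = dpow n N * n definitionally *)
Fixpoint dpow (n N : nat) : nat :=
  match N with 0 => 1 | N'.+1 => (dpow n N' * n)%N end.

Fixpoint tpow {n k : nat} (Phi : 'M[C]_n -> 'M[C]_k) (N : nat)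
  : 'M[C]_(dpow n N) -> 'M[C]_(dpow k N) :=
  match N return 'M[C]_(dpow n N) -> 'M[C]_(dpow k N) with
  | 0 => fun X => X
  | N'.+1 => tens_map (@tpow n k Phi N') Phi
  end.
Arguments tpow {n k} Phi N _.

Definition unitary {n : nat} (U : 'M[C]_n) : Prop := U *m mxadj U = 1%:M.

Definition spectral_dec {n : nat} (A : 'M[C]_n) (Ud : 'M[C]_n * 'rV[R]_n)
  : Prop :=
  unitary Ud.1 /\
  A = Ud.1 *m diag_mx (map_mx (fun x => x%:C) Ud.2) *m mxadj Ud.1.

Definition mxfun {n : nat} (f : R -> R) (A : 'M[C]_n) : 'M[C]_n :=
  let Ud := xget (1%:M, 0) [set Ud | spectral_dec A Ud] in
  Ud.1 *m diag_mx (map_mx (fun x => (f x)%:C) Ud.2) *m mxadj Ud.1.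

Definition xlnx (x : R) : R := if x == 0 then 0 else x * ln x.

Definition entropy {n : nat} (s : 'M[C]_n) : R :=
  - complex.Re (\tr (mxfun xlnx s)).

Definition Smin {n k : nat} (Phi : 'M[C]_n -> 'M[C]_k) : R :=
  inf [set entropy (Phi rho) | rho in [set rho : 'M[C]_n | density rho]].

Definition holevo {n k : nat} (Phi : 'M[C]_n -> 'M[C]_k) : R :=
  sup [set x | exists (m : nat) (p : 'I_m -> R) (rho : 'I_m -> 'M[C]_n),
        [/\ forall i, 0 <= p i, \sum_(i < m) p i = 1,
            forall i, density (rho i)
          & x = entropy (Phi (\sum_(i < m) (p i)%:C *: rho i))
                - \sum_(i < m) p i * entropy (Phi (rho i))]].

Definition capacity {n k : nat} (Phi : 'M[C]_n -> 'M[C]_k) : R :=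
  limn (fun N : nat => holevo (tpow Phi N.+1) / (N.+1)%:R).

(* orthonormal family M_1..M_{n^2-1} of traceless Hermitian matrices
   (hence an orthonormal basis of H_{n,0}, which has dimension n^2-1) *)
Definition onb_traceless {n : nat} (M : 'I_(n ^ 2 - 1) -> 'M[C]_n) : Prop :=
  [/\ forall i, hermitian (M i), forall i, \tr (M i) = 0
    & forall i j, \tr (M i *m M j) = (i == j)%:R].

(* the matrix A_Phi, (A_Phi)_{ij} = Tr[Phi(M_i) Phi(M_j)] (a real number) *)
Definition Amat {n k : nat} (Phi : 'M[C]_n -> 'M[C]_k)
  (M : 'I_(n ^ 2 - 1) -> 'M[C]_n) : 'M[R]_(n ^ 2 - 1) :=
  \matrix_(i, j) complex.Re (\tr (Phi (M i) *m Phi (M j))).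

(* operator norm of a real symmetric PSD matrix = its largest eigenvalue *)
Definition lmax {m : nat} (A : 'M[R]_m) : R :=
  sup [set a : R | eigenvalue A a].

Definition gammaQ (n k : nat) (a : R) : R :=
  if n%:R >= k%:R * a then k%:R^-1 + (1 - n%:R^-1) * a else a.

End QDefs.
Arguments tpow {R n k} Phi N _.

(* Main.v *)
Require Import Defs.
From HB Require Import structures.
From mathcomp Require Import all_boot all_order all_algebra.
From mathcomp Require Import all_classical all_reals all_analysis.
From mathcomp Require Import complex mxtens ring.
Import Order.TTheory GRing.Theory Num.Theory.
Import numFieldNormedType.Exports.
Local Open Scope ring_scope.

Set Implicit Arguments.
Unset Strict Implicit.
Unset Printing Implicit Defensive.

(** The von Neumann entropy dominates the Renyi-2 entropy, so it suffices to
show Tr[(Phi^{(x)N} rho)^2] <= gamma^N.  Expanding Y in the orthonormal basis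
I/sqrt n, M_1, ..., and using that Phi I is a multiple of I, the spectral theorem
for A_Phi gives |Phi Y|^2 <= a |Y|^2 + b |Tr Y|^2 in Hilbert-Schmidt norm, with
a = |A_Phi| and b = max(0, 1/k - a/n), and then gamma = a + b.  Applied to the
last tensor factor, the a-term leaves Phi^{(x)N} (x) id acting on the whole
state, and the b-term leaves Phi^{(x)N} acting on a partial trace; both are
controlled by induction once the bound is stated with an arbitrary ancilla, i.e.
for positive block matrices (X_uv).  The limits exist by Fekete's lemma, the
entropy being additive on product states, and
chi(Phi^{(x)N}) <= N log k - S_min(Phi^{(x)N}) turns (1) into (2). *)

(** * Positive semidefinite kernels on finite types *)

Section PositiveKernels.
Variable R : realType.
Local Notation C := R[i].
Implicit Types I J : finType.

(* A complex form with nonnegative values is automatically Hermitian, so no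
   symmetry is required of [K]. *)
Definition pd I (K : I -> I -> C) : Prop :=
  forall w : I -> C, 0 <= \sum_x \sum_y (w x)^* * K x y * w y.

Lemma sum_fiber I J (h : J -> I) (a : J -> C) (g : I -> C) :
  \sum_x a x * g (h x) = \sum_i (\sum_(x | h x == i) a x) * g i.
Proof.
rewrite (partition_big h predT) //; apply: eq_bigr => i _.
by rewrite mulr_suml; apply: eq_bigr => x /eqP <-.
Qed.

(** The pulled-back form at [w] is the form of [K] at the push-forward of [w], that is, its sums
    over the fibres of [h]. As [h] is arbitrary, this covers relabelling, passing to a submatrix,
    and repeating an index. *)
Lemma pd_comp I J (h : J -> I) (K : I -> I -> C) :
  pd K -> pd (fun x y => K (h x) (h y)).
Proof.
move=> K_pd w; have := K_pd (fun i => \sum_(x | h x == i) w x).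
congr (0 <= _).
transitivity (\sum_x (w x)^* * (\sum_j K (h x) j * \sum_(y | h y == j) w y)).
  rewrite (sum_fiber h (fun x => (w x)^*)
    (fun i => \sum_j K i j * \sum_(y | h y == j) w y)).
  apply: eq_bigr => i _; rewrite rmorph_sum mulr_sumr.
  by apply: eq_bigr => j _; rewrite mulrA.
apply: eq_bigr => x _.
under eq_bigr do rewrite mulrC.
rewrite -(sum_fiber h w) mulr_sumr.
by apply: eq_bigr => y _; rewrite -mulrA [w y * _]mulrC.
Qed.

Lemma pd_eq I (K L : I -> I -> C) : K =2 L -> pd K -> pd L.
Proof.
move=> KL K_pd w; have := K_pd w; congr (0 <= _).
by apply: eq_bigr => x _; apply: eq_bigr => y _; rewrite KL.
Qed.

Lemma pd_sum I J (K : J -> I -> I -> C) :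
  (forall j, pd (K j)) -> pd (fun x y => \sum_j K j x y).
Proof.
move=> K_pd w.
have -> : \sum_x \sum_y (w x)^* * (\sum_j K j x y) * w y =
    \sum_j \sum_x \sum_y (w x)^* * K j x y * w y.
  rewrite [RHS]exchange_big; apply: eq_bigr => x _.
  rewrite [RHS]exchange_big; apply: eq_bigr => y _.
  by rewrite mulr_sumr mulr_suml.
by apply: sumr_ge0 => j _; apply: K_pd.
Qed.

Lemma pd2E (K : bool -> bool -> C) : pd K -> forall a b : C,
  0 <= a^* * K true true * a + a^* * K true false * b +
       (b^* * K false true * a + b^* * K false false * b).
Proof.
by move=> K_pd a b; have := K_pd (fun t => if t then a else b); rewrite !big_bool.
Qed.

Lemma pd_diag_ge0 I (K : I -> I -> C) x : pd K -> 0 <= K x x.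
Proof.
move=> /(pd_comp (fun _ : bool => x)) /pd2E /(_ 1 0).
by rewrite !(conjC1, conjC0, mul0r, mulr0, mul1r, mulr1, addr0).
Qed.

(** Polarization: the form is real at the vectors (1, 1) and (1, ['i]) supported on [x], [y], and
    the diagonal entries are real. This gives two linear relations between the off-diagonal entries
    and their conjugates, whose difference is twice the claim. *)
Lemma pd_herm I (K : I -> I -> C) x y : pd K -> K y x = (K x y)^*.
Proof.
move=> K_pd; have xx := pd_diag_ge0 x K_pd; have yy := pd_diag_ge0 y K_pd.
move: K_pd => /(pd_comp (fun b : bool => if b then x else y)) /pd2E H.
have := H 1 1; have := H 1 'i.
rewrite !(conjC1, conjCi, mul1r, mulr1).
have -> : - 'i * K y y * 'i = K y y :> C.
  by rewrite !mulNr mulrAC -expr2 sqrCi mulN1r opprK.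
move=> /ger0_real/CrealP + /ger0_real/CrealP.
rewrite !rmorphD !rmorphM !rmorphN /= conjCi.
have /CrealP -> := ger0_real xx; have /CrealP -> := ger0_real yy.
set a := K x y; set b := K y x; set a' := a^*; set b' := b^*.
move=> E1 E2.
move/eqP: E1; rewrite -subr_eq0 => /eqP E1.
move/eqP: E2; rewrite -subr_eq0 => /eqP E2.
have {}E1 : 'i * (b' - a' - a + b) = 0 by rewrite -[RHS]E1; ring.
have {}E2 : a' + b' - a - b = 0 by rewrite -[RHS]E2; ring.
have {}E1 : b' - a' - a + b = 0.
  by move/eqP: E1; rewrite mulf_eq0 (negPf (neq0Ci _)) => /eqP.
apply/eqP; rewrite -subr_eq0 -(mulrI_eq0 _ (@mulfI _ 2%:R _)) ?pnatr_eq0 //.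
by apply/eqP; rewrite -[RHS]subr0 -{1}E1 -E2; ring.
Qed.

(** Cauchy-Schwarz for a 2 by 2 minor. Evaluating the form at [(s * K x y, t)] with real [s], [t]
    gives a nonnegative real quadratic form [Q]. *)
Lemma pd_normr_le I (K : I -> I -> C) x y :
  pd K -> `|K x y| ^+ 2 <= K x x * K y y.
Proof.
move=> K_pd; have xx := pd_diag_ge0 x K_pd; have yy := pd_diag_ge0 y K_pd.
have yx := pd_herm x y K_pd.
move: K_pd => /(pd_comp (fun b : bool => if b then x else y)) /pd2E H.
have Q (s t : C) : s \is Num.real -> t \is Num.real ->
    0 <= s ^+ 2 * `|K x y| ^+ 2 * K x x + (s * t *+ 2) * `|K x y| ^+ 2 + t ^+ 2 * K y y.
  move=> /CrealP sR /CrealP tR; have := H (s * K x y) t.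
  rewrite /= yx rmorphM /= sR tR normCK; congr (0 <= _); ring.
have [x0|x0] := eqVneq (K x x) 0.
  have [->|k0] := eqVneq (K x y) 0; first by rewrite normr0 expr0n /= mulr_ge0.
  have k2 : 0 < `|K x y| ^+ 2 by rewrite exprn_gt0 // normr_gt0.
  (* With [K x x = 0] and [t = 1], [Q] is affine in [s]; this value of [s] makes it [- (K y y + 2)],
     a contradiction. *)
  have tR : - (K y y + 1) / `|K x y| ^+ 2 \is Num.real.
    by rewrite realM ?realV ?realN ?realD ?real1 ?ger0_real // ltW.
  have := Q _ 1 tR (real1 _).
  rewrite x0 mulr0 add0r expr1n mul1r mulr1 mulrnAl divfK ?gt_eqF //.
  have -> : - (K y y + 1) *+ 2 + K y y = - (K y y + 2%:R) by ring.
  by rewrite oppr_ge0 lt_geF // ltr_wpDl ?ltr0n.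
have xx0 : 0 < K x x by rewrite lt0r x0 xx.
(* At this point [Q] equals [K x x] times the determinant of the minor. *)
have := Q (-1) (K x x) (rpredN1 _) (ger0_real xx).
rewrite sqrrN expr1n mul1r.
have -> : `|K x y| ^+ 2 * K x x + (-1 * K x x *+ 2) * `|K x y| ^+ 2 + K x x ^+ 2 * K y y
  = K x x * (K x x * K y y - `|K x y| ^+ 2) by ring.
by rewrite pmulr_rge0 // subr_ge0.
Qed.

Lemma psdP n (A : 'M[C]_n) : psd A <-> pd (fun x y => A x y).
Proof.
have E (v : 'cV[C]_n) :
    (mxadj v *m A *m v) 0 0 = \sum_x \sum_y (v x 0)^* * A x y * v y 0.
  rewrite !mxE exchange_big /=; apply: eq_bigr => y _; rewrite !mxE mulr_suml.
  by apply: eq_bigr => x _; rewrite !mxE.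
split=> [[_ A_ge0] w|A_pd]; last split.
- have := A_ge0 (\col_x w x); rewrite E; congr (0 <= _).
  by apply: eq_bigr => x _; apply: eq_bigr => y _; rewrite !mxE.
- by apply/matrixP => x y; rewrite !mxE (pd_herm y x A_pd).
- by move=> v; rewrite E; apply: (A_pd (fun x => v x 0)).
Qed.

End PositiveKernels.

(** * Tensor products of maps, complete positivity, and the purity of tensor-power outputs *)

Section TensorMaps.
Variable R : realType.
Local Notation C := R[i].
Local Notation idx a b := (mxtens_index (a, b)).
Implicit Types I J : finType.

Lemma sum_mxtens (V : nmodType) m n (f : 'I_(m * n) -> V) :
  \sum_s f s = \sum_a \sum_b f (idx a b).
Proof.
rewrite pair_big /= (reindex (@mxtens_index m n)) /=; first by apply: eq_bigr => -[].
by exists (@mxtens_unindex m n) => ? _; rewrite (mxtens_indexK, mxtens_unindexK).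
Qed.

Definition lin n k (F : 'M[C]_n -> 'M[C]_k) : Prop :=
  forall (a : C) X Y, F (a *: X + Y) = a *: F X + F Y.

Lemma lin0 n k (F : 'M[C]_n -> 'M[C]_k) : lin F -> F 0 = 0.
Proof.
move=> /(_ 1 0 0); rewrite !scale1r addr0 => /eqP.
by rewrite -subr_eq subrr => /eqP.
Qed.

Lemma linD n k (F : 'M[C]_n -> 'M[C]_k) X Y : lin F -> F (X + Y) = F X + F Y.
Proof. by move=> /(_ 1 X Y); rewrite !scale1r. Qed.

Lemma linZ n k (F : 'M[C]_n -> 'M[C]_k) a X : lin F -> F (a *: X) = a *: F X.
Proof. by move=> F_lin; have := F_lin a X 0; rewrite (lin0 F_lin) !addr0. Qed.

Lemma lin_sum n k (F : 'M[C]_n -> 'M[C]_k) J (X : J -> 'M[C]_n) :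
  lin F -> F (\sum_j X j) = \sum_j F (X j).
Proof.
move=> F_lin; apply: (big_morph F (id1 := 0) (op1 := +%R)); last exact: lin0.
by move=> Y Z; rewrite linD.
Qed.

Lemma lin_delta n k (F : 'M[C]_n -> 'M[C]_k) X : lin F ->
  F X = \sum_a \sum_b X a b *: F (delta_mx a b).
Proof.
move=> F_lin; rewrite {1}(matrix_sum_delta X) lin_sum //.
apply: eq_bigr => a _; rewrite lin_sum //.
by apply: eq_bigr => b _; rewrite linZ.
Qed.

(** The indices of the second tensor factor are frozen, so [X] is the sum of the [blk X a b]
    tensored with the matrix units, and the sum of the diagonal blocks is the partial trace over the
    second factor. *)
Definition blk n1 n2 (X : 'M[C]_(n1 * n2)) (a b : 'I_n2) : 'M[C]_n1 :=
  \matrix_(i, j) X (idx i a) (idx j b).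

(** The tensor product acts in two stages: [F] on each block, then [G] on the matrix that collects
    one fixed entry of all these images. Later arguments treat the stages separately. *)
Lemma tens_mapE n1 k1 n2 k2 (F : 'M[C]_n1 -> 'M[C]_k1) (G : 'M[C]_n2 -> 'M[C]_k2)
    X p q c d : lin F -> lin G ->
  tens_map F G X (idx p c) (idx q d) = G (\matrix_(a, b) F (blk X a b) p q) c d.
Proof.
move=> F_lin G_lin; rewrite (lin_delta _ G_lin) [RHS]summxE.
under [RHS]eq_bigr do rewrite summxE.
rewrite [RHS]pair_big /= /tens_map pair_big /= summxE.
under [LHS]eq_bigr do rewrite pair_big /= summxE.
rewrite exchange_big; apply: eq_bigr => -[a b] _ /=.
rewrite !mxE (lin_delta _ F_lin) [X in _ = X * _]summxE.
rewrite mulr_suml; under [RHS]eq_bigr do rewrite summxE mulr_suml.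
rewrite [RHS]pair_big /=; apply: eq_bigr => -[i j] _ /=.
by rewrite !mxE !mxtens_indexK mulrA.
Qed.

Lemma tens_map_lin n1 k1 n2 k2 (F : 'M[C]_n1 -> 'M[C]_k1)
  (G : 'M[C]_n2 -> 'M[C]_k2) : lin (tens_map F G).
Proof.
move=> a X Y; rewrite /tens_map.
do 4 (rewrite scaler_sumr -big_split; apply: eq_bigr => ? _).
by rewrite !mxE scalerDl scalerA.
Qed.

Lemma tpow_lin n k (Phi : 'M[C]_n -> 'M[C]_k) N : lin (tpow Phi N).
Proof. by case: N => [//|N]; apply: tens_map_lin. Qed.

(* A block matrix [(X u v)] seen as a kernel on [I * 'I_n].  Letting the ancilla
   be an arbitrary finite type [I] avoids casts along associativity of [muln]. *)
Definition fam I n (X : I -> I -> 'M[C]_n) (x y : I * 'I_n) : C :=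
  X x.1 y.1 x.2 y.2.

Definition cp n k (F : 'M[C]_n -> 'M[C]_k) : Prop :=
  forall I (X : I -> I -> 'M[C]_n), pd (fam X) -> pd (fam (fun u v => F (X u v))).

(** An enumeration of [I] turns the ancilla into an ordinal, as [is_channel] demands; [pd_comp]
    carries positivity there and back. *)
Lemma channel_cp n k (Phi : 'M[C]_n -> 'M[C]_k) : is_channel Phi -> cp Phi.
Proof.
move=> [Phi_lin _ Phi_cp] I X X_pd.
pose h (s : 'I_(#|I| * n)) :=
  (enum_val (mxtens_unindex s).1 : I, (mxtens_unindex s).2).
pose Y := \matrix_(s, t) fam X (h s) (h t).
have /Phi_cp /psdP : psd Y.
  by apply/psdP; apply: pd_eq (pd_comp h X_pd) => s t; rewrite mxE.
move=> /(pd_comp (fun x : I * 'I_k => idx (enum_rank x.1) x.2)).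
apply: pd_eq => -[u c] [v d] /=; rewrite tens_mapE //.
congr (Phi _ _ _); apply/matrixP => a b.
by rewrite !mxE /fam /h !mxtens_indexK /= !enum_rankK.
Qed.

(** At each stage the index of the idle factor joins the ancilla: [F] is used with ancilla
    [I * 'I_n2], then [G] with ancilla [I * 'I_k1]. *)
Lemma tens_map_cp n1 k1 n2 k2 (F : 'M[C]_n1 -> 'M[C]_k1)
    (G : 'M[C]_n2 -> 'M[C]_k2) :
  lin F -> lin G -> cp F -> cp G -> cp (tens_map F G).
Proof.
move=> F_lin G_lin F_cp G_cp I X X_pd.
pose Y (x y : I * 'I_n2) := blk (X x.1 y.1) x.2 y.2.
have Y_pd : pd (fam Y).
  apply: pd_eq (pd_comp (fun x : I * 'I_n2 * 'I_n1 => (x.1.1, idx x.2 x.1.2)) X_pd).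
  by move=> x y; rewrite /fam /Y mxE.
pose Z (x y : I * 'I_k1) :=
  \matrix_(a, b) F (blk (X x.1 y.1) a b) x.2 y.2 : 'M[C]_n2.
have Z_pd : pd (fam Z).
  apply: pd_eq (pd_comp (fun x : I * 'I_k1 * 'I_n2 => ((x.1.1, x.2), x.1.2))
    (F_cp _ _ Y_pd)).
  by move=> x y; rewrite /fam /Z mxE.
have [h hK] : exists h : 'I_(k1 * k2) -> 'I_k1 * 'I_k2,
    forall p c, h (idx p c) = (p, c).
  by exists (@mxtens_unindex k1 k2) => p c; apply: mxtens_indexK.
apply: pd_eq (pd_comp (fun x : I * 'I_(k1 * k2) =>
  ((x.1, (h x.2).1), (h x.2).2)) (G_cp _ _ Z_pd)).
move=> [u s] [v t]; rewrite /fam /=.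
case: (mxtens_indexP s) => p c; case: (mxtens_indexP t) => q d.
by rewrite tens_mapE // !hK.
Qed.

Lemma tpow_cp n k (Phi : 'M[C]_n -> 'M[C]_k) N :
  is_channel Phi -> cp (tpow Phi N).
Proof.
move=> Phi_ch; have [Phi_lin _ _] := Phi_ch.
elim: N => [|N IH]; first by move=> I X; apply: pd_eq.
by apply: tens_map_cp; [apply: tpow_lin|..|apply: channel_cp].
Qed.

Lemma tens_map_tr n1 k1 n2 k2 (F : 'M[C]_n1 -> 'M[C]_k1)
    (G : 'M[C]_n2 -> 'M[C]_k2) X : lin F -> lin G ->
    (forall Y, \tr (F Y) = \tr Y) -> (forall Y, \tr (G Y) = \tr Y) ->
  \tr (tens_map F G X) = \tr X.
Proof.
move=> F_lin G_lin F_tr G_tr; rewrite /mxtrace !sum_mxtens.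
transitivity (\sum_p \sum_a F (blk X a a) p p).
  apply: eq_bigr => p _; under eq_bigr do rewrite tens_mapE //.
  rewrite -/(mxtrace _) G_tr; apply: eq_bigr => a _; by rewrite mxE.
rewrite exchange_big [RHS]exchange_big; apply: eq_bigr => a _.
by rewrite -/(mxtrace _) F_tr; apply: eq_bigr => i _; rewrite mxE.
Qed.

Lemma tpow_tr n k (Phi : 'M[C]_n -> 'M[C]_k) N X :
  is_channel Phi -> \tr (tpow Phi N X) = \tr X.
Proof.
move=> [Phi_lin Phi_tr _]; elim: N X => [//|N IH] X /=.
by rewrite tens_map_tr //; apply: tpow_lin.
Qed.

Lemma cp_psd n k (F : 'M[C]_n -> 'M[C]_k) X : cp F -> psd X -> psd (F X).
Proof.
move=> F_cp /psdP X_pd; apply/psdP.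
pose Y (_ _ : 'I_1) := X.
have /F_cp : pd (fam Y) by apply: pd_eq (pd_comp (fun x : 'I_1 * 'I_n => x.2) X_pd).
by move=> /(pd_comp (fun x => (ord0 : 'I_1, x))); apply: pd_eq.
Qed.

Lemma tpow_density n k (Phi : 'M[C]_n -> 'M[C]_k) N rho :
  is_channel Phi -> density rho -> density (tpow Phi N rho).
Proof.
move=> Phi_ch [rho_psd rho_tr]; split; last by rewrite tpow_tr.
by apply: cp_psd => //; apply: tpow_cp.
Qed.

Lemma pd_rank1 I (f : I -> C) : pd (fun x y => (f x)^* * f y).
Proof.
move=> w; have -> : \sum_x \sum_y (w x)^* * ((f x)^* * f y) * w y =
    `|\sum_x f x * w x| ^+ 2.
  rewrite normCK rmorph_sum mulr_sumr.
  apply: eq_bigr => x _; rewrite mulr_suml; apply: eq_bigr => y _.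
  by rewrite rmorphM /=; ring.
by rewrite exprn_ge0.
Qed.

(** The Choi matrix of [F], whose blocks are the images of the matrix units, is positive and hence
    Hermitian; linearity extends this symmetry to all [X]. *)
Lemma cp_mxadj n k (F : 'M[C]_n -> 'M[C]_k) X :
  lin F -> cp F -> mxadj (F X) = F (mxadj X).
Proof.
move=> F_lin F_cp; pose E (u v : 'I_n) : 'M[C]_n := delta_mx u v.
(* The block matrix of all matrix units is the rank-one form of the unnormalised maximally entangled
   vector. *)
have /F_cp E_pd : pd (fam E).
  apply: pd_eq (pd_rank1 (fun x : 'I_n * 'I_n => (x.2 == x.1)%:R)).
  by move=> x y; rewrite /fam /E mxE conjC_nat -natrM mulnb.
apply/matrixP => a b; rewrite !mxE !(lin_delta _ F_lin) !summxE rmorph_sum.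
rewrite [RHS](eq_bigr (fun i => \sum_j (mxadj X i j *: F (delta_mx i j)) a b)); last first.
  by move=> i _; rewrite summxE.
rewrite [RHS]exchange_big; apply: eq_bigr => u _.
rewrite summxE rmorph_sum; apply: eq_bigr => v _.
have := pd_herm (u, b) (v, a) E_pd; rewrite /fam /= => h.
by rewrite !mxE rmorphM /= -h.
Qed.

(** The squared Hilbert-Schmidt norm; for a density matrix it is the purity. *)
Definition hs m n (X : 'M[C]_(m, n)) : C := \sum_a \sum_b `|X a b| ^+ 2.

Lemma hs_ge0 m n (X : 'M[C]_(m, n)) : 0 <= hs X.
Proof. by apply: sumr_ge0 => a _; apply: sumr_ge0 => b _; apply: exprn_ge0. Qed.

(** The bound on [G] is used at each matrix [Z p q] of (p, q) entries of the images under [F].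
    Summed over p and q, the norms of [Z p q] regroup into those of the [F (blk X a b)], while
    [\tr (Z p q)] is an entry of [F] at the partial trace. *)
Lemma hs_tens_map n1 k1 n2 k2 (F : 'M[C]_n1 -> 'M[C]_k1)
    (G : 'M[C]_n2 -> 'M[C]_k2) (al be : C) X : lin F -> lin G ->
    (forall Y, hs (G Y) <= al * hs Y + be * `|\tr Y| ^+ 2) ->
  hs (tens_map F G X) <=
    al * (\sum_a \sum_b hs (F (blk X a b))) + be * hs (F (\sum_a blk X a a)).
Proof.
move=> F_lin G_lin G_hs.
pose Z p q := \matrix_(a, b) F (blk X a b) p q.
have -> : hs (tens_map F G X) = \sum_p \sum_q hs (G (Z p q)).
  rewrite /hs sum_mxtens; apply: eq_bigr => p _.
  rewrite exchange_big sum_mxtens; apply: eq_bigr => q _.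
  rewrite exchange_big; apply: eq_bigr => c _; apply: eq_bigr => d _.
  by rewrite tens_mapE.
have -> : \sum_a \sum_b hs (F (blk X a b)) = \sum_p \sum_q hs (Z p q).
  rewrite /hs pair_big [RHS]pair_big /=.
  under eq_bigr do rewrite pair_big.
  under [RHS]eq_bigr do rewrite pair_big.
  rewrite exchange_big; apply: eq_bigr => -[p q] _; apply: eq_bigr => -[a b] _ /=.
  by rewrite mxE.
have -> : hs (F (\sum_a blk X a a)) = \sum_p \sum_q `|\tr (Z p q)| ^+ 2.
  apply: eq_bigr => p _; apply: eq_bigr => q _; rewrite lin_sum // summxE.
  by congr (`| _ | ^+ 2); apply: eq_bigr => a _; rewrite mxE.
rewrite !mulr_sumr -big_split; apply: ler_sum => p _ /=.
by rewrite !mulr_sumr -big_split; apply: ler_sum => q _ /=.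
Qed.

(* The ancilla [I] makes the induction go through: the step uses it for [I * 'I_n]
   (blocks of [X]) and for [I] (partial trace of [X]). *)
Lemma sum_hs_tpow n k (Phi : 'M[C]_n -> 'M[C]_k) (al be : C) :
    lin Phi -> 0 <= al -> 0 <= be ->
    (forall Y, hs (Phi Y) <= al * hs Y + be * `|\tr Y| ^+ 2) ->
  forall N I (X : I -> I -> 'M[C]_(dpow n N)), pd (fam X) ->
  \sum_u \sum_v hs (tpow Phi N (X u v)) <=
    (al + be) ^+ N * (\sum_u \tr (X u u)) ^+ 2.
Proof.
move=> Phi_lin al_ge0 be_ge0 Phi_hs; elim=> [|N IH] I X X_pd.
  (* Since [dpow n 0] is 1, each [X u v] is a scalar, and the base case is Cauchy-Schwarz summed
     over all pairs. *)
  have -> : \sum_u \tr (X u u) = \sum_u X u u 0 0.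
    by apply: eq_bigr => u _; rewrite /mxtrace big_ord1.
  rewrite expr0 mul1r expr2 big_distrlr /=; apply: ler_sum => u _.
  apply: ler_sum => v _; rewrite /hs !big_ord1.
  exact: (pd_normr_le (u, 0) (v, 0) X_pd).
pose Y (x y : I * 'I_n) := blk (X x.1 y.1) x.2 y.2.
have Y_pd : pd (fam Y).
  apply: pd_eq (pd_comp (fun x : I * 'I_n * 'I_(dpow n N) =>
    (x.1.1, idx x.2 x.1.2 : 'I_(dpow n N.+1))) X_pd).
  by move=> x y; rewrite /fam /Y mxE.
pose T u v := \sum_a blk (X u v) a a.
have T_pd : pd (fam T).
  apply: pd_eq (pd_sum (fun a : 'I_n => pd_comp (fun x : I * 'I_(dpow n N) =>
    ((x.1, a), x.2)) Y_pd)).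
  by move=> x y; rewrite /fam /T summxE.
have trT : \sum_u \tr (T u u) = \sum_u \tr (X u u).
  apply: eq_bigr => u _; rewrite /T raddf_sum /mxtrace sum_mxtens.
  by rewrite exchange_big; apply: eq_bigr => i _; apply: eq_bigr => a _; rewrite mxE.
have trY : \sum_x \tr (Y x x) = \sum_u \tr (X u u).
  rewrite -trT -(pair_bigA _ (fun u a => \tr (Y (u, a) (u, a)))) /=.
  by apply: eq_bigr => u _; rewrite raddf_sum.
apply: (@le_trans _ _ (\sum_u \sum_v (al * (\sum_a \sum_b
    hs (tpow Phi N (blk (X u v) a b))) + be * hs (tpow Phi N (T u v))))).
  apply: ler_sum => u _; apply: ler_sum => v _.
  by apply: hs_tens_map => //; apply: tpow_lin.
have -> : \sum_u \sum_v (al * (\sum_a \sum_b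
    hs (tpow Phi N (blk (X u v) a b))) + be * hs (tpow Phi N (T u v))) =
  al * (\sum_x \sum_y hs (tpow Phi N (Y x y))) +
  be * (\sum_u \sum_v hs (tpow Phi N (T u v))).
  rewrite !mulr_sumr.
  rewrite -(pair_bigA _ (fun u a => al * \sum_y hs (tpow Phi N (Y (u, a) y)))) /=.
  rewrite -big_split; apply: eq_bigr => u _ /=.
  rewrite big_split -!mulr_sumr; congr (al * _ + _); rewrite exchange_big.
  apply: eq_bigr => a _.
  by rewrite -(pair_bigA _ (fun v b => hs (tpow Phi N (Y (u, a) (v, b))))).
(* [Y] and [T] both have the total trace of [X], so the two induction bounds coincide and their
   coefficients add up to [al + be]. *)
rewrite exprS -mulrA mulrDl; apply: lerD; apply: ler_wpM2l => //.
  by rewrite -trY; apply: IH.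
by rewrite -trT; apply: IH.
Qed.

Lemma hs_tpow_density n k (Phi : 'M[C]_n -> 'M[C]_k) (al be : C) :
    lin Phi -> 0 <= al -> 0 <= be ->
    (forall Y, hs (Phi Y) <= al * hs Y + be * `|\tr Y| ^+ 2) ->
  forall N rho, density rho -> hs (tpow Phi N rho) <= (al + be) ^+ N.
Proof.
move=> Phi_lin al_ge0 be_ge0 Phi_hs N rho [/psdP rho_pd rho_tr].
pose X (_ _ : 'I_1) := rho.
have /(sum_hs_tpow Phi_lin al_ge0 be_ge0 Phi_hs) : pd (fam X).
  by apply: pd_eq (pd_comp (fun x : 'I_1 * 'I_(dpow n N) => x.2) rho_pd).
by rewrite !big_ord1 /X rho_tr expr1n mulr1.
Qed.

End TensorMaps.

(** * Spectral decompositions and the entropy as a function of the eigenvalues *)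

Section Spectral.
Variable R : realType.
Local Notation C := R[i].
Local Notation rdiag d := (diag_mx (map_mx (real_complex R) d)).

Lemma mxadjK m n (A : 'M[C]_(m, n)) : mxadj (mxadj A) = A.
Proof. by apply/matrixP => a b; rewrite !mxE conjCK. Qed.

Lemma mxadjM m n p (A : 'M[C]_(m, n)) (B : 'M[C]_(n, p)) :
  mxadj (A *m B) = mxadj B *m mxadj A.
Proof. by rewrite /mxadj map_mxM trmx_mul. Qed.

Lemma spectral_hermitian n (A : 'M[C]_n) : Defs.hermitian A ->
  exists U (d : 'rV[R]_n), spectral_dec A (U, d).
Proof.
move=> A_herm.
have A_hermsym : A \is hermitianmx n false Num.conj.
  by apply/is_hermitianmxP; rewrite expr0 scale1r -map_trmx; symmetry.
have U_unitary := spectral_unitarymx A.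
have /orthomx_spectralP := hermitian_normalmx A_hermsym.
rewrite invmx_unitary // -map_trmx -/(mxadj _) => AE.
exists (mxadj (spectralmx A)), (map_mx (@complex.Re R) (spectral_diag A)); split=> /=.
  rewrite /unitary mxadjK; apply: mulmx1C; rewrite /mxadj map_trmx.
  exact/unitarymxP.
rewrite mxadjK {1}AE; congr (_ *m diag_mx _ *m _).
apply/matrixP => i j; rewrite !mxE RRe_real //.
by have /mxOverP := hermitian_spectral_diag_real A_hermsym; apply.
Qed.

Lemma unitaryC n (U : 'M[C]_n) : unitary U -> mxadj U *m U = 1%:M.
Proof. exact: mulmx1C. Qed.

Lemma mxadj_sqnorm n (v : 'cV[C]_n) :
  (mxadj v *m v) 0 0 = \sum_i `|v i 0| ^+ 2.
Proof. by rewrite !mxE; apply: eq_bigr => i _; rewrite !mxE normCK mulrC. Qed.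

Lemma spectral_form n (A U : 'M[C]_n) d (v : 'cV[C]_n) :
    spectral_dec A (U, d) ->
  (mxadj v *m A *m v) 0 0 = \sum_l (d 0 l)%:C%C * `|(mxadj U *m v) l 0| ^+ 2.
Proof.
move=> [_ /= ->]; have -> : mxadj v *m (U *m rdiag d *m mxadj U) *m v =
    mxadj (mxadj U *m v) *m (rdiag d *m (mxadj U *m v)).
  by rewrite mxadjM mxadjK !mulmxA.
set w := mxadj U *m v; rewrite !mxE; apply: eq_bigr => l _.
by rewrite mul_diag_mx !mxE normCK; ring.
Qed.

Lemma spectral_sqnorm n (U : 'M[C]_n) (v : 'cV[C]_n) : unitary U ->
  \sum_l `|(mxadj U *m v) l 0| ^+ 2 = \sum_l `|v l 0| ^+ 2.
Proof.
move=> U_unitary; rewrite -!mxadj_sqnorm mxadjM mxadjK mulmxA.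
by rewrite -(mulmxA (mxadj v)) U_unitary mulmx1.
Qed.

Lemma spectral_eigenvalueP n (A U : 'M[C]_n) d (a : R) :
    spectral_dec A (U, d) ->
  reflect (exists l, a = d 0 l) (eigenvalue A a%:C%C).
Proof.
move=> [U_unitary /= AE]; have U'U := unitaryC U_unitary.
have UA : mxadj U *m A = rdiag d *m mxadj U by rewrite AE !mulmxA U'U mul1mx.
apply: (iffP idP) => [/eigenvalueP[v vA v0]|[l ->]].
  have AU : A *m U = U *m rdiag d by rewrite AE -!mulmxA U'U mulmx1.
  have w0 : v *m U != 0.
    apply: contra_neq v0 => vU0.
    by rewrite -[v]mulmx1 -U_unitary mulmxA vU0 mul0mx.
  have [l wl] : exists l, (v *m U) 0 l != 0.
    apply/existsP; rewrite -negb_forall; apply: contra w0 => /forallP w0.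
    by apply/eqP/rowP => l; rewrite [RHS]mxE; apply/eqP.
  exists l; have : (v *m A *m U) 0 l = (v *m (A *m U)) 0 l by rewrite mulmxA.
  rewrite vA -scalemxAl AU mulmxA mul_mx_diag !mxE mulrC.
  by move=> /(mulfI _) h; apply: (@complexI R); apply: h; rewrite !mxE in wl.
apply/eigenvalueP; exists (row l (mxadj U)).
  by rewrite -row_mul UA row_mul row_diag_mx mxE -scalemxAl -rowE.
apply/eqP => /(congr1 (fun r => r *m U)); rewrite -row_mul U'U mul0mx.
by move=> /rowP/(_ l); rewrite !mxE eqxx => /eqP; rewrite oner_eq0.
Qed.

Lemma char_poly_spectral n (A U : 'M[C]_n) d : spectral_dec A (U, d) ->
  char_poly A = \prod_(x <- [seq (d 0 l)%:C%C | l <- enum 'I_n]) ('X - x%:P).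
Proof.
move=> [U_unitary /= ->]; set D := rdiag d; set V := mxadj U.
have -> : \prod_(x <- [seq (d 0 l)%:C%C | l <- enum 'I_n]) ('X - x%:P) = char_poly D.
  rewrite char_poly_trig ?diag_mx_is_trig // big_map big_enum.
  by apply: eq_bigr => l _; rewrite !mxE eqxx mulr1n.
rewrite /char_poly.
have UV : map_mx polyC U *m map_mx polyC V = 1%:M.
  by rewrite -map_mxM U_unitary map_mx1.
have -> : char_poly_mx (U *m D *m V) =
    map_mx polyC U *m char_poly_mx D *m map_mx polyC V.
  rewrite /char_poly_mx mulmxBr mulmxBl !map_mxM; congr (_ - _).
  by rewrite mul_mx_scalar -scalemxAl UV scalemx1.
by rewrite !det_mulmx mulrAC -det_mulmx UV det1 mul1r.
Qed.

(** [mxfun] works with a decomposition selected by choice. Any two decompositions of [s] yield the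
    same factored characteristic polynomial, hence the same eigenvalues up to permutation, and the
    sum of [xlnx] does not see the order. *)
Lemma entropyE n (s U : 'M[C]_n) d : spectral_dec s (U, d) ->
  entropy s = - \sum_l xlnx (d 0 l).
Proof.
move=> s_dec; rewrite /entropy /mxfun; congr (- _).
(* The given pair inhabits the set, so [xget] returns a genuine decomposition and not its
   default. *)
have : spectral_dec s (xget (1%:M, 0) [set Ud | spectral_dec s Ud]%classic).
  exact: (@xgetI _ _ [set Ud | spectral_dec s Ud]%classic (U, d)).
case: (xget _ _) => U' d' s_dec'.
have /prod_XsubC_eq : \prod_(x <- [seq (d 0 l)%:C%C | l <- enum 'I_n]) ('X - x%:P) =
    \prod_(x <- [seq (d' 0 l)%:C%C | l <- enum 'I_n]) ('X - x%:P).
  by rewrite -(char_poly_spectral s_dec) -(char_poly_spectral s_dec').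
move=> dd'; have [U'_unitary _] := s_dec'; rewrite /= in U'_unitary *.
rewrite mxtrace_mulC mulmxA unitaryC // mul1mx mxtrace_diag.
have E (e : 'rV[R]_n) : \sum_l xlnx (e 0 l) =
    \sum_(x <- [seq (e 0 l)%:C%C | l <- enum 'I_n]) xlnx (@complex.Re R x).
  by rewrite big_map big_enum.
rewrite E (perm_big _ dd') -E (raddf_sum (@complex.Re R : Rcomplex R -> R)).
by apply: eq_bigr => l _; rewrite !mxE.
Qed.

End Spectral.

(** * The Hilbert-Schmidt bound for a unital channel and the constant gamma *)

Section PurityBound.
Variable R : realType.
Local Notation C := R[i].

Definition ip n (X Y : 'M[C]_n) : C := \tr (mxadj X *m Y).

Lemma mxadjD m n (X Y : 'M[C]_(m, n)) : mxadj (X + Y) = mxadj X + mxadj Y.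
Proof. by rewrite /mxadj map_mxD raddfD. Qed.

Lemma mxadjZ m n a (X : 'M[C]_(m, n)) : mxadj (a *: X) = a^* *: mxadj X.
Proof. by rewrite /mxadj map_mxZ linearZ. Qed.

Lemma ipE n (X Y : 'M[C]_n) : ip X Y = \sum_b \sum_a (X a b)^* * Y a b.
Proof.
apply: eq_bigr => b _; rewrite !mxE; apply: eq_bigr => a _; by rewrite !mxE.
Qed.

Lemma hs_ip n (X : 'M[C]_n) : hs X = ip X X.
Proof.
rewrite ipE exchange_big; apply: eq_bigr => a _; apply: eq_bigr => b _.
by rewrite normCK mulrC.
Qed.

Lemma ip_conj n (X Y : 'M[C]_n) : ip Y X = (ip X Y)^*.
Proof.
rewrite !ipE rmorph_sum; apply: eq_bigr => b _; rewrite rmorph_sum.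
by apply: eq_bigr => a _; rewrite rmorphM /= conjCK mulrC.
Qed.

Lemma ip_sumr n J (X : 'M[C]_n) (y : J -> C) (B : J -> 'M[C]_n) (r : seq J) :
  ip X (\sum_(j <- r) y j *: B j) = \sum_(j <- r) y j * ip X (B j).
Proof.
rewrite /ip mulmx_sumr raddf_sum; apply: eq_bigr => j _.
by rewrite -scalemxAr /= mxtraceZ.
Qed.

Lemma ip_suml n J (X : 'M[C]_n) (y : J -> C) (B : J -> 'M[C]_n) (r : seq J) :
  ip (\sum_(j <- r) y j *: B j) X = \sum_(j <- r) (y j)^* * ip (B j) X.
Proof.
rewrite ip_conj ip_sumr rmorph_sum; apply: eq_bigr => j _.
by rewrite rmorphM /= -ip_conj.
Qed.

Lemma hs_sum n (J : finType) (y : J -> C) (B : J -> 'M[C]_n) :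
  hs (\sum_j y j *: B j) = \sum_i \sum_j (y i)^* * ip (B i) (B j) * y j.
Proof.
rewrite hs_ip ip_suml; apply: eq_bigr => i _.
by rewrite ip_sumr mulr_sumr; apply: eq_bigr => j _; rewrite mulrA mulrAC.
Qed.

Lemma hsZ m n a (X : 'M[C]_(m, n)) : hs (a *: X) = `|a| ^+ 2 * hs X.
Proof.
rewrite /hs mulr_sumr; apply: eq_bigr => i _; rewrite mulr_sumr.
by apply: eq_bigr => j _; rewrite mxE normrM exprMn.
Qed.

Lemma hsD_orth n (X Y : 'M[C]_n) : ip X Y = 0 -> hs (X + Y) = hs X + hs Y.
Proof.
move=> XY0; have YX0 : ip Y X = 0 by rewrite ip_conj XY0 conjC0.
rewrite !hs_ip; move: XY0 YX0; rewrite /ip.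
rewrite mxadjD mulmxDl !mulmxDr !mxtraceD => -> ->.
by rewrite addr0 add0r.
Qed.

Lemma hs1 n : hs (1%:M : 'M[C]_n) = n%:R.
Proof. by rewrite hs_ip /ip /mxadj map_mx1 trmx1 mulmx1 mxtrace1. Qed.

Lemma mxadj1 n : mxadj (1%:M : 'M[C]_n) = 1%:M.
Proof. by rewrite /mxadj map_mx1 trmx1. Qed.

Lemma hermitian_real_mx m (A : 'M[R]_m) :
  A^T = A -> Defs.hermitian (map_mx (real_complex R) A).
Proof.
move=> A_sym; apply/matrixP => i j; rewrite !mxE -[in RHS]A_sym mxE.
by apply/CrealP; rewrite complex_real.
Qed.

Lemma eigenvalue_real_mx m (A : 'M[R]_m) a :
  eigenvalue (map_mx (real_complex R) A) a%:C%C = eigenvalue A a.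
Proof.
by rewrite !eigenvalue_root_char -map_char_poly (fmorph_root (real_complex R)).
Qed.

Lemma symmetric_eigenvalue_le m (A : 'M[R]_m) a : A^T = A ->
  eigenvalue A a -> a <= lmax A.
Proof.
move=> A_sym Aa; apply: ub_le_sup => //.
have [U [d A_dec]] := spectral_hermitian (hermitian_real_mx A_sym).
exists (\sum_l `|d 0 l|) => b /=.
rewrite -eigenvalue_real_mx => /(spectral_eigenvalueP _ A_dec)[l ->].
rewrite (bigD1 l) //= (le_trans (ler_norm _)) // lerDl.
by apply: sumr_ge0.
Qed.

(** In an orthonormal eigenbasis the form is a sum of eigenvalues weighted by squared moduli. The
    vector is complex although [A] is real, because the bound will be applied to matrices that need
    not be Hermitian. *)
Lemma rayleigh m (A : 'M[R]_m) (y : 'I_m -> C) : A^T = A ->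
  \sum_i \sum_j (y i)^* * (A i j)%:C%C * y j <=
    (lmax A)%:C%C * \sum_i `|y i| ^+ 2.
Proof.
move=> A_sym.
have [U [d A_dec]] := spectral_hermitian (hermitian_real_mx A_sym).
have [/= U_unitary _] := A_dec.
pose v : 'cV[C]_m := \col_i y i.
have -> : \sum_i \sum_j (y i)^* * (A i j)%:C%C * y j =
    (mxadj v *m map_mx (real_complex R) A *m v) 0 0.
  rewrite !mxE exchange_big /=; apply: eq_bigr => j _; rewrite !mxE mulr_suml.
  by apply: eq_bigr => i _; rewrite !mxE.
have -> : \sum_i `|y i| ^+ 2 = \sum_i `|v i 0| ^+ 2.
  by apply: eq_bigr => i _; rewrite mxE.
rewrite (spectral_form _ A_dec) -(spectral_sqnorm _ U_unitary) mulr_sumr.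
apply: ler_sum => l _; apply: ler_wpM2r; first exact: exprn_ge0.
rewrite lecR; apply: symmetric_eigenvalue_le => //.
by rewrite -eigenvalue_real_mx; apply/(spectral_eigenvalueP _ A_dec); exists l.
Qed.

Section Basis.
Variables (n : nat) (M : 'I_(n ^ 2 - 1) -> 'M[C]_n).
Hypothesis n_gt0 : (0 < n)%N.
Hypothesis M_onb : onb_traceless M.

Let M_herm i : mxadj (M i) = M i. Proof. by case: M_onb => h _ _; apply: h. Qed.
Let M_tr i : \tr (M i) = 0. Proof. by case: M_onb. Qed.
Let M_ip i j : ip (M i) (M j) = (i == j)%:R.
Proof. by rewrite /ip M_herm; case: M_onb. Qed.

Lemma hs_expansion (y0 : C) (y : 'I_(n ^ 2 - 1) -> C) :
  hs (y0 *: 1%:M + \sum_i y i *: M i) =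
    n%:R * `|y0| ^+ 2 + \sum_i `|y i| ^+ 2.
Proof.
rewrite hsD_orth; last first.
  rewrite ip_sumr big1 // => i _.
  rewrite /ip mxadjZ mxadj1.
  by rewrite -scalemxAl mul1mx mxtraceZ M_tr !mulr0.
rewrite hsZ hs1 mulrC hs_sum; congr (_ + _); apply: eq_bigr => i _.
rewrite (bigD1 i) //= M_ip eqxx mulr1 big1 ?addr0 => [|j ji].
  by rewrite normCK mulrC.
by rewrite M_ip eq_sym (negPf ji) mulr0 mul0r.
Qed.

(** By [hs_expansion] a vanishing combination has zero coefficients, so the identity and the [M i]
    are independent over the complex numbers; there are [n ^ 2] of them, so they span. *)
Lemma expansion (Y : 'M[C]_n) : exists (y0 : C) (y : 'I_(n ^ 2 - 1) -> C),
  Y = y0 *: 1%:M + \sum_i y i *: M i.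
Proof.
pose B : 'M[C]_(1 + (n ^ 2 - 1), n * n) :=
  col_mx (mxvec 1%:M) (\matrix_i mxvec (M i)).
have BE (D : 'rV_(1 + (n ^ 2 - 1))) : vec_mx (D *m B) =
    D 0 (lshift _ 0) *: 1%:M + \sum_i D 0 (rshift 1 i) *: M i.
  rewrite mulmx_sum_row big_split_ord big_ord1 linearD linear_sum /=.
  congr (_ + _).
    by rewrite linearZ /= rowKu row_id mxvecK.
  by apply: eq_bigr => i _; rewrite linearZ /= rowKd rowK mxvecK.
have B_free : row_free B.
  apply: inj_row_free => D DB0.
  have := hs_expansion (D 0 (lshift _ 0)) (fun i => D 0 (rshift 1 i)).
  rewrite -BE DB0 linear0 hs_ip /ip mulmx0 mxtrace0 => /esym/eqP.
  rewrite paddr_eq0 ?mulr_ge0 ?sumr_ge0 // => /andP[].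
  rewrite mulf_eq0 pnatr_eq0 (gtn_eqF n_gt0) /= sqrf_eq0 normr_eq0 => /eqP D0.
  rewrite psumr_eq0 // => /allP D1.
  apply/rowP => j; rewrite [RHS]mxE; case: (splitP j) => [j' jE|j' jE].
    by rewrite -[RHS]D0; congr (D _ _); apply: val_inj; rewrite /= jE ord1.
  have := D1 j' (mem_index_enum _); rewrite /= sqrf_eq0 normr_eq0 => /eqP D1j'.
  by rewrite -[RHS]D1j'; congr (D _ _); apply: val_inj.
have B_full : row_full B.
  by rewrite /row_full (eqP B_free) subnKC ?expn_gt0 ?n_gt0 // mulnn.
have /submxP[D YE] := submx_full (mxvec Y) B_full.
exists (D 0 (lshift _ 0)), (fun i => D 0 (rshift 1 i)).
by rewrite -BE -YE mxvecK.
Qed.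

Variables (k : nat) (Phi : 'M[C]_n -> 'M[C]_k).
Hypothesis k_gt0 : (0 < k)%N.
Hypothesis Phi_channel : is_channel Phi.
Hypothesis Phi_unital : unital Phi.

Let Phi_lin : lin Phi. Proof. by case: Phi_channel. Qed.

Let Phi_mxadj X : mxadj (Phi X) = Phi (mxadj X).
Proof. exact/cp_mxadj/channel_cp. Qed.

Lemma unital1 : Phi 1%:M = (n%:R / k%:R) *: 1%:M.
Proof.
have n0 : (n%:R : C) != 0 by rewrite pnatr_eq0 -lt0n.
have -> : 1%:M = n%:R *: ((n%:R)^-1 *: 1%:M) :> 'M[C]_n.
  by rewrite scalerA divff // scale1r.
by rewrite linZ // Phi_unital scalerA.
Qed.

(** Taking the real part in [Amat] loses nothing: [Phi] preserves Hermitian matrices, and the trace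
    of a product of two of these is its own conjugate. *)
Lemma AmatE i j : ((Amat Phi M) i j)%:C%C = ip (Phi (M i)) (Phi (M j)).
Proof.
rewrite mxE RRe_real; first by rewrite /ip Phi_mxadj M_herm.
apply/CrealP; rewrite -[in LHS](M_herm i) -Phi_mxadj -/(ip _ _) -ip_conj.
by rewrite /ip Phi_mxadj M_herm mxtrace_mulC.
Qed.

Lemma Amat_sym : (Amat Phi M)^T = Amat Phi M.
Proof. by apply/matrixP => i j; rewrite !mxE mxtrace_mulC. Qed.

Lemma lmax_Amat_ge0 : 0 <= lmax (Amat Phi M).
Proof.
(* For [n = 1] the matrix is empty and has no eigenvalue, and [sup] of the empty set is 0. *)
have [m_gt0|] := ltnP 0 (n ^ 2 - 1); last first.
  rewrite leqn0 => /eqP m0; rewrite /lmax (_ : mkset _ = set0) ?sup0 //.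
  apply/seteqP; split=> // a /= /eigenvalueP[v _] /eqP[].
  apply/rowP => -[j jm]; exfalso; by rewrite m0 in jm.
pose i0 := Ordinal m_gt0.
(* At a coordinate vector the form is a diagonal entry, namely the squared norm of [Phi (M i0)]. *)
have := rayleigh (fun i => (i == i0)%:R) Amat_sym.
rewrite (bigD1 i0) //= [X in _ + X <= _]big1 => [|j /negPf ->]; last first.
  by rewrite big1 // => l _; rewrite conjC0 !mul0r.
rewrite addr0 (bigD1 i0) //= [X in _ + X <= _]big1 => [|j /negPf ->]; last first.
  by rewrite mulr0.
rewrite addr0 [X in _ <= _ * X](bigD1 i0) //=.
rewrite [X in _ <= _ * (_ + X)]big1 => [|j /negPf ->]; last first.
  by rewrite normr0 expr0n.
rewrite ?eqxx conjC1 mul1r !mulr1 AmatE -hs_ip normr1 expr1n addr0 mulr1.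
by move=> /(le_trans (hs_ge0 _)); rewrite ler0c.
Qed.

(** [Phi] sends the identity to a multiple of the identity, orthogonal to the traceless [Phi (M i)],
    so the two components of [Y] contribute separately. [rayleigh] handles the traceless one; what
    remains is [n ^ 2 * |y0| ^ 2] times [be - (1/k - a/n)]. *)
Lemma hs_channel_le (be : R) Y : 0 <= be ->
    (k%:R)^-1 - lmax (Amat Phi M) / n%:R <= be ->
  hs (Phi Y) <= (lmax (Amat Phi M))%:C%C * hs Y + be%:C%C * `|\tr Y| ^+ 2.
Proof.
set a := lmax _ => be_ge0 a_be.
have [y0 [y YE]] := expansion Y.
have trY : \tr Y = n%:R * y0.
  rewrite YE mxtraceD mxtraceZ mxtrace1 raddf_sum big1 ?addr0 1?mulrC // => i _.
  by rewrite /= mxtraceZ M_tr mulr0.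
have Phi_Y : Phi Y = (y0 * (n%:R / k%:R)) *: 1%:M + \sum_i y i *: Phi (M i).
  rewrite YE linD // linZ // unital1 scalerA lin_sum //.
  by under eq_bigr do rewrite linZ //.
have -> : hs (Phi Y) = `|y0| ^+ 2 * (n%:R ^+ 2 / k%:R) +
    \sum_i \sum_j (y i)^* * ((Amat Phi M) i j)%:C%C * y j.
  rewrite Phi_Y hsD_orth; last first.
    rewrite ip_sumr big1 // => i _.
    rewrite /ip mxadjZ mxadj1.
    rewrite -scalemxAl mul1mx mxtraceZ; case: Phi_channel => _ -> _.
    by rewrite M_tr !mulr0.
  rewrite hsZ hs1 hs_sum; congr (_ + _); last first.
    by apply: eq_bigr => i _; apply: eq_bigr => j _; rewrite AmatE.
  rewrite normrM exprMn normrM normfV !normr_nat -mulrA; congr (_ * _).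
  by field; rewrite pnatr_eq0 -lt0n.
have := rayleigh y Amat_sym; rewrite -/a => ray.
rewrite {1}YE hs_expansion trY normrM exprMn normr_nat.
apply: (le_trans (lerD (lexx _) ray)).
rewrite mulrDr addrAC lerD2r -subr_ge0.
have -> : a%:C%C * (n%:R * `|y0| ^+ 2) + be%:C%C * (n%:R ^+ 2 * `|y0| ^+ 2) -
    `|y0| ^+ 2 * (n%:R ^+ 2 / k%:R) =
    (n%:R ^+ 2 * `|y0| ^+ 2) * (be - (k%:R^-1 - a / n%:R))%:C%C.
  rewrite !rmorphB rmorphM !fmorphV !rmorph_nat; field.
  by rewrite !pnatr_eq0 -!lt0n k_gt0 n_gt0.
by rewrite mulr_ge0 ?mulr_ge0 ?exprn_ge0 ?ler0n // ler0c subr_ge0.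
Qed.

Lemma hs_tpow_le N rho : density rho ->
  hs (tpow Phi N rho) <= ((gammaQ n k (lmax (Amat Phi M))) ^+ N)%:C%C.
Proof.
set a := lmax _ => rho_dens; have a_ge0 : 0 <= a := lmax_Amat_ge0.
(* The least coefficient that [hs_channel_le] admits; the two cases of the maximum are the two cases
   of [gammaQ]. *)
pose be := Num.max 0 ((k%:R)^-1 - a / n%:R).
have -> : gammaQ n k a = a + be.
  have kn : (k%:R * a <= n%:R) = (0 <= k%:R^-1 - a / n%:R).
    by rewrite subr_ge0 ler_pdivrMr ?ltr0n // ler_pdivlMl ?ltr0n.
  rewrite /gammaQ kn /be; case: leP => _; last by rewrite addr0.
  by field; rewrite !pnatr_eq0 -!lt0n k_gt0 n_gt0.
rewrite rmorphXn rmorphD; apply: hs_tpow_density => //; rewrite ?ler0c //.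
- by rewrite le_max lexx.
- by move=> Y; apply: hs_channel_le; rewrite /be le_max lexx ?orbT.
Qed.

Lemma gammaQ_gt0 : 0 < gammaQ n k (lmax (Amat Phi M)).
Proof.
have a_ge0 := lmax_Amat_ge0; rewrite /gammaQ; case: ifPn => [_|].
  rewrite ltr_wpDr ?invr_gt0 ?ltr0n // mulr_ge0 // subr_ge0 invf_le1 ?ltr0n //.
  by rewrite ler1n.
rewrite -ltNge => h; rewrite -(@pmulr_rgt0 _ k%:R) ?ltr0n //.
by apply: le_lt_trans h; rewrite ler0n.
Qed.

End Basis.
End PurityBound.

(** * Entropy bounds, and additivity on product states *)

Section Entropy.
Variable R : realType.
Local Notation C := R[i].
Local Notation rdiag d := (diag_mx (map_mx (real_complex R) d)).

Lemma ln_le_subr1 (x : R) : 0 < x -> ln x <= x - 1.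
Proof.
move=> x_gt0; rewrite -{1}[x](subrK 1) addrC; apply: le_ln1Dx.
by rewrite ltrBrDl subrr.
Qed.

Lemma sum1_neq0 (J : finType) (d : J -> R) :
  \sum_j d j = 1 -> exists j, d j != 0.
Proof.
move=> d_sum; apply/existsP; rewrite -negb_forall; apply/negP => /forallP d0.
have := oner_neq0 R; rewrite -d_sum big1 ?eqxx // => j _; exact/eqP.
Qed.

(** The tangent bound [ln x <= x - 1] is applied to each [w j / t], with [t] the mean; the
    right-hand sides average to 0. Positivity is asked only where the weight is nonzero, so that
    eigenvalues of singular states may serve as [w]. *)
Lemma jensen_ln (J : finType) (d w : J -> R) :
    (forall j, 0 <= d j) -> \sum_j d j = 1 -> (forall j, d j != 0 -> 0 < w j) ->
  \sum_j d j * ln (w j) <= ln (\sum_j d j * w j).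
Proof.
move=> d_ge0 d_sum w_gt0; set t := \sum_j d j * w j.
have dw_ge0 j : 0 <= d j * w j.
  have [->|/w_gt0/ltW] := eqVneq (d j) 0; first by rewrite mul0r.
  exact: mulr_ge0.
have t_gt0 : 0 < t.
  rewrite lt0r sumr_ge0 // andbT; apply/eqP => /eqP.
  rewrite psumr_eq0 // => /allP t0; have := oner_neq0 R; rewrite -d_sum.
  rewrite big1 ?eqxx // => j _; apply/eqP/negPn/negP => dj.
  have := t0 j (mem_index_enum _).
  by rewrite /= mulf_eq0 (negPf dj) (gt_eqF (w_gt0 _ dj)).
rewrite -subr_le0 -[ln t]mul1r -d_sum mulr_suml -sumrB.
have t_sum : \sum_j d j * (w j / t - 1) = 0.
  under eq_bigr do rewrite mulrBr mulr1 mulrA.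
  by rewrite sumrB -mulr_suml -/t divff ?gt_eqF // d_sum subrr.
rewrite -[leRHS]t_sum.
apply: ler_sum => j _; rewrite -mulrBr.
have [->|dj] := eqVneq (d j) 0; first by rewrite !mul0r.
by rewrite ler_wpM2l // -ln_div ?posrE ?w_gt0 // ln_le_subr1 // divr_gt0 ?w_gt0.
Qed.

Lemma spectral_psd n (A U : 'M[C]_n) d : spectral_dec A (U, d) ->
  (forall l, 0 <= d 0 l) -> psd A.
Proof.
move=> A_dec d_ge0; apply/psdP => w.
have -> : \sum_x \sum_y (w x)^* * A x y * w y =
    (mxadj (\col_x w x) *m A *m (\col_x w x)) 0 0.
  rewrite !mxE exchange_big /=; apply: eq_bigr => j _; rewrite !mxE mulr_suml.
  by apply: eq_bigr => i _; rewrite !mxE.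
rewrite (spectral_form _ A_dec); apply: sumr_ge0 => l _.
by rewrite mulr_ge0 ?exprn_ge0 // ler0c.
Qed.

Lemma density_spectral n (s : 'M[C]_n) : density s ->
  exists U (d : 'rV[R]_n),
    [/\ spectral_dec s (U, d), forall l, 0 <= d 0 l & \sum_l d 0 l = 1].
Proof.
move=> [[s_herm s_ge0] s_tr]; have [U [d s_dec]] := spectral_hermitian s_herm.
have [/= U_unitary sE] := s_dec; exists U, d; split=> // [l|].
  have := s_ge0 (U *m delta_mx l 0); rewrite (spectral_form _ s_dec).
  rewrite mulmxA unitaryC // mul1mx (bigD1 l) //= big1 => [|j /negPf jl].
    by rewrite mxE !eqxx normr1 expr1n mulr1 addr0 ler0c.
  by rewrite mxE jl normr0 expr0n mulr0.
apply: (@complexI R); rewrite rmorph1 -s_tr sE mxtrace_mulC mulmxA unitaryC //.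
by rewrite mul1mx mxtrace_diag rmorph_sum; apply: eq_bigr => l _; rewrite mxE.
Qed.

Lemma hs_spectral n (s U : 'M[C]_n) d : psd s -> spectral_dec s (U, d) ->
  hs s = (\sum_l d 0 l * d 0 l)%:C%C.
Proof.
move=> [s_herm _] [/= U_unitary sE].
rewrite hs_ip /ip s_herm sE.
have -> : U *m rdiag d *m mxadj U *m (U *m rdiag d *m mxadj U) =
    U *m (rdiag d *m rdiag d) *m mxadj U.
  by rewrite !mulmxA -(mulmxA (U *m rdiag d)) unitaryC // mulmx1.
rewrite mxtrace_mulC (mulmxA (mxadj U)) unitaryC // mul1mx rmorph_sum.
by apply: eq_bigr => l _; rewrite mul_diag_mx !mxE eqxx mulr1n rmorphM.
Qed.

Lemma xlnxE (x : R) : xlnx x = x * ln x.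
Proof. by rewrite /xlnx; case: eqVneq => // ->; rewrite mul0r. Qed.

Lemma entropy_ge0 n (s : 'M[C]_n) : density s -> 0 <= entropy s.
Proof.
move=> /density_spectral[U [d [s_dec d_ge0 d_sum]]].
rewrite (entropyE s_dec) oppr_ge0; apply: sumr_le0 => l _.
rewrite xlnxE mulr_ge0_le0 // ln_le0 // -d_sum (bigD1 l) //= lerDl.
exact: sumr_ge0.
Qed.

(** Jensen with the inverse eigenvalues as [w]. *)
Lemma entropy_le_ln n (s : 'M[C]_n) : density s -> entropy s <= ln n%:R.
Proof.
move=> /density_spectral[U [d [s_dec d_ge0 d_sum]]].
rewrite (entropyE s_dec) -sumrN.
have -> : \sum_l - xlnx (d 0 l) = \sum_l d 0 l * ln (d 0 l)^-1.
  apply: eq_bigr => l _; rewrite xlnxE.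
  have [->|dl] := eqVneq (d 0 l) 0; first by rewrite !mul0r oppr0.
  by rewrite lnV ?mulrN // posrE lt0r dl d_ge0.
apply: (le_trans (jensen_ln (d_ge0) d_sum _)) => [l dl|].
  by rewrite invr_gt0 lt0r dl d_ge0.
have [l dl] := sum1_neq0 d_sum.
have dd_ge0 j : 0 <= d 0 j * (d 0 j)^-1 by rewrite mulr_ge0 ?invr_ge0.
have dd_gt0 : 0 < \sum_j d 0 j * (d 0 j)^-1.
  rewrite (bigD1 l) //= divff // ltr_pwDl // sumr_ge0 // => j _.
have n_gt0 : (0 < n)%N by apply: leq_trans (ltn_ord l).
rewrite ler_ln ?posrE ?ltr0n //.
(* A zero eigenvalue contributes 0 and any other contributes 1: the sum is the rank of [s]. *)
apply: (@le_trans _ _ (\sum_(j < n) 1)); last by rewrite sumr_const card_ord.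
by apply: ler_sum => j _; have [->|dj] := eqVneq (d 0 j) 0; rewrite ?mul0r // divff.
Qed.

(** Jensen with the eigenvalues themselves as [w]: the mean is then the purity, and this is the
    comparison with the Renyi-2 entropy. *)
Lemma entropy_ge_purity n (s : 'M[C]_n) (q : R) :
  density s -> hs s <= q%:C%C -> - ln q <= entropy s.
Proof.
move=> s_dens; have [s_psd _] := s_dens.
have [U [d [s_dec d_ge0 d_sum]]] := density_spectral s_dens.
rewrite (hs_spectral s_psd s_dec) lecR (entropyE s_dec) lerN2 => dd_q.
under eq_bigr do rewrite xlnxE.
apply: (le_trans (jensen_ln d_ge0 d_sum _)) => [l dl|].
  by rewrite lt0r dl d_ge0.
have [l dl] := sum1_neq0 d_sum.
have dd_gt0 : 0 < \sum_j d 0 j * d 0 j.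
  rewrite (bigD1 l) //= ltr_wpDr ?sumr_ge0 // => [j _|]; first by rewrite mulr_ge0.
  by rewrite -expr2 exprn_gt0 // lt0r dl d_ge0.
by rewrite ler_ln ?posrE // (lt_le_trans dd_gt0).
Qed.

Lemma density_exists n : (0 < n)%N -> exists s : 'M[C]_n, density s.
Proof.
move=> n_gt0; pose i0 := Ordinal n_gt0; exists (delta_mx i0 i0); split.
  apply/psdP; apply: pd_eq (pd_rank1 (fun x => (x == i0)%:R)) => x y.
  by rewrite mxE conjC_nat -natrM mulnb.
rewrite /mxtrace (bigD1 i0) //= mxE eqxx big1 ?addr0 // => j /negPf ji0.
by rewrite mxE ji0.
Qed.

Lemma density_mix n m (p : 'I_m -> R) (rho : 'I_m -> 'M[C]_n) :
    (forall i, 0 <= p i) -> \sum_i p i = 1 -> (forall i, density (rho i)) ->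
  density (\sum_i (p i)%:C%C *: rho i).
Proof.
move=> p_ge0 p_sum rho_dens; split.
  apply/psdP; apply: (@pd_eq _ _ (fun x y => \sum_i (p i)%:C%C * rho i x y)).
    by move=> x y; rewrite summxE; apply: eq_bigr => i _; rewrite mxE.
  apply: pd_sum => i w; have [/psdP rho_pd _] := rho_dens i.
  have -> : \sum_x \sum_y (w x)^* * ((p i)%:C%C * rho i x y) * w y =
      (p i)%:C%C * \sum_x \sum_y (w x)^* * rho i x y * w y.
    rewrite mulr_sumr; apply: eq_bigr => x _; rewrite mulr_sumr.
    by apply: eq_bigr => y _; ring.
  by rewrite mulr_ge0 ?ler0c.
rewrite raddf_sum -[RHS](rmorph1 (real_complex R)) -p_sum rmorph_sum.
apply: eq_bigr => i _; have [_ rho_tr] := rho_dens i.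
by rewrite /= mxtraceZ rho_tr mulr1.
Qed.

Section Product.
Variables (a b c : nat) (h : 'I_c -> 'I_a * 'I_b).
Hypothesis h_bij : bijective h.

(** The Kronecker product read through an index bijection [h], so that a state on [dpow n (M + N)]
    can be a product without a cast. *)
Definition prodmx (s : 'M[C]_a) (t : 'M[C]_b) : 'M[C]_c :=
  \matrix_(x, y) (s (h x).1 (h y).1 * t (h x).2 (h y).2).

Lemma sum_prod (V : nmodType) (f : 'I_a * 'I_b -> V) :
  \sum_x f (h x) = \sum_i \sum_j f (i, j).
Proof.
rewrite pair_big /= [RHS](reindex h) /=; last exact: onW_bij.
by apply: eq_bigr => x _; case: (h x).
Qed.

Lemma prodmx_mul s t s' t' :
  prodmx s t *m prodmx s' t' = prodmx (s *m s') (t *m t').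
Proof.
apply/matrixP => x y; rewrite !mxE big_distrlr /=.
rewrite -(sum_prod (fun z => s (h x).1 z.1 * s' z.1 (h y).1 *
  (t (h x).2 z.2 * t' z.2 (h y).2))).
by apply: eq_bigr => z _; rewrite !mxE; ring.
Qed.

Lemma prodmx_mxadj s t : mxadj (prodmx s t) = prodmx (mxadj s) (mxadj t).
Proof. by apply/matrixP => x y; rewrite !mxE rmorphM. Qed.

Lemma prodmx_diag (d : 'rV[C]_a) (e : 'rV[C]_b) :
  prodmx (diag_mx d) (diag_mx e) = diag_mx (\row_x (d 0 (h x).1 * e 0 (h x).2)).
Proof.
apply/matrixP => x y; rewrite !mxE.
have -> : (x == y) = ((h x).1 == (h y).1) && ((h x).2 == (h y).2).
  by rewrite -(bij_eq h_bij) -pair_eqE.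
by rewrite mulrnAl mulrnAr -mulrnA mulnb andbC.
Qed.

Lemma prodmx_spectral s t U V d e :
    spectral_dec s (U, d) -> spectral_dec t (V, e) ->
  spectral_dec (prodmx s t) (prodmx U V, \row_x (d 0 (h x).1 * e 0 (h x).2)).
Proof.
move=> [/= U_unitary ->] [/= V_unitary ->]; split=> /=.
  rewrite /unitary prodmx_mxadj prodmx_mul U_unitary V_unitary.
  rewrite -!diag_const_mx prodmx_diag; congr diag_mx.
  by apply/rowP => x; rewrite !mxE mulr1.
rewrite -!prodmx_mul prodmx_mxadj prodmx_diag; congr (_ *m diag_mx _ *m _).
by apply/rowP => x; rewrite !mxE rmorphM.
Qed.

Lemma prodmx_density s t : density s -> density t -> density (prodmx s t).
Proof.
move=> s_dens t_dens.
have [U [d [s_dec d_ge0 d_sum]]] := density_spectral s_dens.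
have [V [e [t_dec e_ge0 e_sum]]] := density_spectral t_dens.
split.
  by apply: (spectral_psd (prodmx_spectral s_dec t_dec)) => l; rewrite mxE mulr_ge0.
have [[_ s_tr] [_ t_tr]] := (s_dens, t_dens).
rewrite /mxtrace; under eq_bigr do rewrite mxE.
rewrite (sum_prod (fun z => s z.1 z.1 * t z.2 z.2)) /= -big_distrlr /=.
by rewrite -/(mxtrace s) -/(mxtrace t) s_tr t_tr mulr1.
Qed.

(** The eigenvalues of the product are the products of eigenvalues; [xlnx] obeys a Leibniz rule on
    products, and both spectra sum to 1. *)
Lemma entropy_prodmx s t : density s -> density t ->
  entropy (prodmx s t) = entropy s + entropy t.
Proof.
move=> s_dens t_dens.
have [U [d [s_dec d_ge0 d_sum]]] := density_spectral s_dens.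
have [V [e [t_dec e_ge0 e_sum]]] := density_spectral t_dens.
rewrite (entropyE s_dec) (entropyE t_dec) (entropyE (prodmx_spectral s_dec t_dec)).
rewrite -opprD; congr (- _); under eq_bigr do rewrite mxE.
rewrite (sum_prod (fun z => xlnx (d 0 z.1 * e 0 z.2))) /=.
have xlnxM (x y : R) : 0 <= x -> 0 <= y -> xlnx (x * y) = xlnx x * y + x * xlnx y.
  rewrite !xlnxE; have [->|x0] := eqVneq x 0; first by rewrite !mul0r addr0.
  have [->|y0] := eqVneq y 0; first by rewrite !(mulr0, mul0r) addr0.
  by move=> x_ge0 y_ge0; rewrite lnM ?posrE ?lt0r ?x0 ?y0 //; ring.
under eq_bigr do under eq_bigr do rewrite xlnxM //.
under eq_bigr do rewrite big_split -!mulr_sumr e_sum mulr1.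
by rewrite big_split /= -mulr_suml d_sum mul1r.
Qed.

End Product.
End Entropy.

(** * Splitting tensor powers, and Fekete's lemma *)

Section TensorPowers.
Variable R : realType.
Local Notation C := R[i].
Local Notation idx a b := (mxtens_index (a, b)).

(* Splits the first [N] tensor factors from the last [M]; [M + N] is written in
   this order because [tpow] peels off the last factor. *)
Fixpoint dsplit n N M : 'I_(dpow n (M + N)) -> 'I_(dpow n N) * 'I_(dpow n M) :=
  match M with
  | 0 => fun x => (x, ord0)
  | M'.+1 => fun x : 'I_(dpow n (M' + N) * n) =>
      let u := mxtens_unindex x in
      let v := dsplit u.1 in (v.1, mxtens_index (v.2, u.2))
  end.

Lemma dsplitS n N M x a : @dsplit n N M.+1 (idx x a) =
  ((@dsplit n N M x).1, idx (@dsplit n N M x).2 a).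
Proof. by cbn [dsplit]; rewrite mxtens_indexK. Qed.

Lemma dsplit_bij n N M : bijective (@dsplit n N M).
Proof.
elim: M => [|M [g gK Kg]].
  by exists (fun z => z.1) => // -[x y] /=; rewrite (ord1 y).
exists (fun z : 'I_(dpow n N) * 'I_(dpow n M * n) =>
  mxtens_index (g (z.1, (mxtens_unindex z.2).1), (mxtens_unindex z.2).2)).
  move=> s; case: (mxtens_indexP (s : 'I_(dpow n (M + N) * n))) => x a.
  rewrite dsplitS; cbn [fst snd]; rewrite mxtens_indexK; cbn [fst snd].
  by case E: (dsplit x) => [p q]; cbn [fst snd]; rewrite -E gK.
case=> x t; case: (mxtens_indexP (t : 'I_(dpow n M * n))) => y a.
cbn [fst snd]; rewrite mxtens_indexK; cbn [fst snd].
by rewrite dsplitS Kg.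
Qed.

(** Induction on [M], peeling the last factor: the blocks of a product are products of [rho] with
    the blocks of [tau]. For [M = 0], [tau] is a scalar. *)
Lemma tpow_prodmx n k (Phi : 'M[C]_n -> 'M[C]_k) N M rho tau : lin Phi ->
  tpow Phi (M + N) (prodmx (@dsplit n N M) rho tau) =
  prodmx (@dsplit k N M) (tpow Phi N rho) (tpow Phi M tau).
Proof.
move=> Phi_lin; elim: M tau => [|M IH] tau.
  have -> : prodmx (@dsplit n N 0) rho tau = tau ord0 ord0 *: rho.
    by apply/matrixP => x y; rewrite !mxE mulrC.
  rewrite linZ; last exact: tpow_lin.
  by apply/matrixP => x y; rewrite !mxE mulrC.
apply/matrixP => s t; case: (mxtens_indexP s) => x c; case: (mxtens_indexP t) => y d.
have tl L := tpow_lin Phi L.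
rewrite [LHS](tens_mapE _ _ _ _ _ (tl _) Phi_lin) [RHS]mxE !dsplitS.
rewrite [X in _ = _ * X](tens_mapE _ _ _ _ _ (tl _) Phi_lin).
set x' := dsplit x; set y' := dsplit y; cbn [fst snd].
have PhiZ al X : al * Phi X c d = Phi (al *: X) c d by rewrite linZ // mxE.
rewrite PhiZ; congr (Phi _ c d).
apply/matrixP => a b; rewrite !mxE.
have -> : blk (prodmx (@dsplit n N M.+1) rho tau) a b =
    prodmx (@dsplit n N M) rho (blk tau a b).
  by apply/matrixP => i j; rewrite !mxE !dsplitS.
by rewrite IH mxE.
Qed.

Lemma dpow_gt0 n N : (0 < n)%N -> (0 < dpow n N)%N.
Proof. by move=> n_gt0; elim: N => // N IH; rewrite /= muln_gt0 IH. Qed.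

Lemma ln_dpow n N : (0 < n)%N -> ln (dpow n N)%:R = N%:R * ln n%:R :> R.
Proof.
move=> n_gt0; elim: N => [|N IH]; first by rewrite ln1 mul0r.
rewrite /= natrM lnM ?posrE ?ltr0n ?dpow_gt0 // IH -[in RHS]natr1; ring.
Qed.

(** The limit is the infimum of the ratios. Given [m] with a nearly minimal ratio, division of the
    index by [m] bounds the ratio at any index by the one at [m], up to a constant over the
    index. *)
Lemma fekete (u : nat -> R) : (forall N, 0 <= u N) ->
    (forall M N, u (M + N)%N <= u N + u M) ->
  cvgn (fun N => u N.+1 / N.+1%:R).
Proof.
move=> u_ge0 u_sub.
have uMn m q : u (q * m)%N <= q%:R * u m + u 0%N.
  elim: q => [|q IH]; first by rewrite mul0n mul0r add0r.
  rewrite mulSn (le_trans (u_sub _ _)) // -natr1 mulrDl mul1r.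
  by rewrite addrAC lerD2r.
pose S := range (fun N => u N.+1 / N.+1%:R).
have S_lb : has_lbound S.
  by exists 0 => _ [N _ <-]; rewrite mulr_ge0 ?invr_ge0.
have S_inf : has_inf S by split=> //; exists (u 1%N / 1); exists 0%N.
apply/cvg_ex; exists (inf S); apply/cvgrPdist_le => e e_gt0.
have [_ [m' _ <-] um] := inf_adherent (divr_gt0 e_gt0 (ltr0Sn R 1)) S_inf.
set m := m'.+1 in um.
(* Dominates the term of any remainder [r < m] together with the [u 0] left over by [uMn]. *)
pose K := \sum_(r < m) u r + u 0%N.
have K_ge0 : 0 <= K by rewrite addr_ge0 ?sumr_ge0.
near=> N.
have lb : inf S <= u N.+1 / N.+1%:R by apply: ge_inf => //; exists N.
rewrite ler0_norm ?subr_le0 // opprB lerBlDl.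
have N0 : 0 < N.+1%:R :> R by rewrite ltr0n.
have uN : u N.+1 <= (N.+1 %/ m)%:R * u m + K.
  rewrite {1}(divn_eq N.+1 m) addnC (le_trans (u_sub _ _)) //.
  rewrite /K [X in _ <= _ + X]addrC addrA; apply: lerD; first exact: uMn.
  rewrite (bigD1 (Ordinal (ltn_pmod N.+1 (ltn0Sn m')))) //= lerDl.
  exact: sumr_ge0.
have -> : inf S + e = (inf S + e / 2) + e / 2 by field.
apply: (@le_trans _ _ (u m / m%:R + K / N.+1%:R)).
  rewrite ler_pdivrMr // mulrDl divfK ?gt_eqF // (le_trans uN) // lerD2r.
  rewrite mulrC -mulrA ler_wpM2l // ler_pdivlMl ?ltr0n // -natrM ler_nat.
  by rewrite mulnC leq_trunc_div.
apply: lerD; first exact: ltW.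
rewrite ler_pdivrMr // mulrC -ler_pdivrMr ?divr_gt0 //.
rewrite (@le_trans _ _ N%:R) ?ler_nat //.
by near: N; apply: nbhs_infty_ger.
Unshelve. all: by end_near.
Qed.

End TensorPowers.

(** * Existence of the limits, and the Holevo quantity against the minimum output entropy *)

Section Capacity.
Variables (R : realType) (n k : nat) (Phi : 'M[R[i]]_n -> 'M[R[i]]_k).
Hypotheses (n_gt0 : (0 < n)%N) (k_gt0 : (0 < k)%N).
Hypothesis Phi_channel : is_channel Phi.

Let Phi_lin : lin Phi. Proof. by case: Phi_channel. Qed.

Let dens N rho : density rho -> density (tpow Phi N rho).
Proof. exact: tpow_density. Qed.

Lemma Smin_le N rho : density rho -> Smin (tpow Phi N) <= entropy (tpow Phi N rho).
Proof.
move=> rho_dens; apply: ge_inf; last by exists rho.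
by exists 0 => _ [s s_dens <-]; apply/entropy_ge0/dens.
Qed.

Lemma Smin_ge N x : (forall rho, density rho -> x <= entropy (tpow Phi N rho)) ->
  x <= Smin (tpow Phi N).
Proof.
move=> x_le; apply: lb_le_inf; last by move=> _ [s s_dens <-]; apply: x_le.
have [rho rho_dens] := density_exists R (dpow_gt0 N n_gt0).
by exists (entropy (tpow Phi N rho)); exists rho.
Qed.

(** Product inputs give product outputs, whose entropies add. Applying [Smin_ge] once per factor
    avoids choosing minimizers. *)
Lemma Smin_subadd M N :
  Smin (tpow Phi (M + N)) <= Smin (tpow Phi N) + Smin (tpow Phi M).
Proof.
rewrite -lerBlDr; apply: Smin_ge => rho rho_dens.
rewrite lerBlDr -lerBlDl; apply: Smin_ge => tau tau_dens; rewrite lerBlDl.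
rewrite -(entropy_prodmx (dsplit_bij k N M)); try exact: dens.
rewrite -tpow_prodmx //; apply: Smin_le.
by apply: prodmx_density => //; apply: dsplit_bij.
Qed.

Definition ensemble_info N m (p : 'I_m -> R) (rho : 'I_m -> 'M[R[i]]_(dpow n N)) :=
  entropy (tpow Phi N (\sum_(i < m) (p i)%:C%C *: rho i))
    - \sum_(i < m) p i * entropy (tpow Phi N (rho i)).

(** The average output has entropy at most the log of the dimension, and each single output at least
    [Smin]. This bounds the set in [holevo], so its supremum is meaningful, and also links the two
    claims of the theorem. *)
Lemma ensemble_info_le N m p (rho : 'I_m -> 'M[R[i]]_(dpow n N)) :
    (forall i, 0 <= p i) -> \sum_(i < m) p i = 1 -> (forall i, density (rho i)) ->
  ensemble_info p rho <= N%:R * ln k%:R - Smin (tpow Phi N).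
Proof.
move=> p_ge0 p_sum rho_dens; rewrite -ln_dpow //; apply: lerB.
  by apply/entropy_le_ln/dens/density_mix.
rewrite -[leLHS]mul1r -p_sum mulr_suml; apply: ler_sum => i _.
by apply: ler_wpM2l => //; apply: Smin_le.
Qed.

Lemma ensemble_info_le_holevo N m p (rho : 'I_m -> 'M[R[i]]_(dpow n N)) :
    (forall i, 0 <= p i) -> \sum_(i < m) p i = 1 -> (forall i, density (rho i)) ->
  ensemble_info p rho <= holevo (tpow Phi N).
Proof.
move=> p_ge0 p_sum rho_dens; apply: ub_le_sup; last by exists m, p, rho.
exists (N%:R * ln k%:R - Smin (tpow Phi N)) => _ [m' [p' [rho' [? ? ? ->]]]].
exact: ensemble_info_le.
Qed.

Lemma holevo_le N x :
    (forall m p (rho : 'I_m -> 'M[R[i]]_(dpow n N)), (forall i, 0 <= p i) ->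
      \sum_(i < m) p i = 1 -> (forall i, density (rho i)) ->
      ensemble_info p rho <= x) ->
  holevo (tpow Phi N) <= x.
Proof.
move=> x_ge; apply: ge_sup.
  have [rho rho_dens] := density_exists R (dpow_gt0 N n_gt0).
  exists (ensemble_info (fun _ : 'I_1 => 1) (fun=> rho)).
  by exists 1%N, (fun=> 1), (fun=> rho); split=> //; rewrite big_ord1.
by move=> _ [m [p [rho [? ? ? ->]]]]; apply: x_ge.
Qed.

(** Two ensembles combine into the ensemble of product states with product weights. Its average is
    the product of the averages, so both entropy terms add. *)
Lemma holevo_superadd M N :
  holevo (tpow Phi N) + holevo (tpow Phi M) <= holevo (tpow Phi (M + N)).
Proof.
rewrite -lerBrDr; apply: holevo_le => m p rho p_ge0 p_sum rho_dens.
rewrite lerBrDr -lerBrDl; apply: holevo_le => m' q tau q_ge0 q_sum tau_dens.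
rewrite lerBrDl.
have hb := dsplit_bij n N M; have hb' := dsplit_bij k N M.
pose pq (s : 'I_(m * m')) := p (mxtens_unindex s).1 * q (mxtens_unindex s).2.
pose om (s : 'I_(m * m')) := prodmx (@dsplit n N M)
  (rho (mxtens_unindex s).1) (tau (mxtens_unindex s).2).
have pq_sum : \sum_s pq s = 1 by rewrite /pq -mulr_sum p_sum q_sum mulr1.
have om_dens s : density (om s) by apply: prodmx_density.
have -> : ensemble_info p rho + ensemble_info q tau = ensemble_info pq om.
  rewrite /ensemble_info.
  have -> : \sum_s (pq s)%:C%C *: om s = prodmx (@dsplit n N M)
      (\sum_i (p i)%:C%C *: rho i) (\sum_j (q j)%:C%C *: tau j).
    apply/matrixP => x y; rewrite summxE [RHS]mxE !summxE mulr_sum.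
    by apply: eq_bigr => s _; rewrite !mxE rmorphM /=; ring.
  rewrite tpow_prodmx // entropy_prodmx //; try by apply/dens/density_mix.
  have -> : \sum_s pq s * entropy (tpow Phi (M + N) (om s)) =
      \sum_i p i * entropy (tpow Phi N (rho i)) +
      \sum_j q j * entropy (tpow Phi M (tau j)).
    rewrite sum_mxtens.
    transitivity (\sum_i \sum_j (p i * entropy (tpow Phi N (rho i)) * q j +
        p i * (q j * entropy (tpow Phi M (tau j))))).
      apply: eq_bigr => i _; apply: eq_bigr => j _.
      rewrite /pq /om !mxtens_indexK tpow_prodmx // entropy_prodmx //; try exact: dens.
      by rewrite /=; ring.
    under eq_bigr do rewrite big_split -!mulr_sumr q_sum mulr1.
    by rewrite big_split /= -mulr_suml p_sum mul1r.
  by rewrite opprD addrACA.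
by apply: ensemble_info_le_holevo => // s; rewrite mulr_ge0.
Qed.

Lemma holevo_le_Smin N :
  holevo (tpow Phi N) <= N%:R * ln k%:R - Smin (tpow Phi N).
Proof. by apply: holevo_le => m p rho *; apply: ensemble_info_le. Qed.

Lemma Smin_ge0 N : 0 <= Smin (tpow Phi N).
Proof. by apply: Smin_ge => rho rho_dens; apply/entropy_ge0/dens. Qed.

Lemma Smin_rate_cvg : cvgn (fun N => Smin (tpow Phi N.+1) / N.+1%:R).
Proof.
by apply: (@fekete R (fun N => Smin (tpow Phi N)));
  [apply: Smin_ge0|apply: Smin_subadd].
Qed.

(** Fekete applies to the defect [N log k - holevo], which is nonnegative by [holevo_le_Smin] and
    subadditive because [holevo] is superadditive. *)
Lemma holevo_rate_cvg : cvgn (fun N => holevo (tpow Phi N.+1) / N.+1%:R).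
Proof.
pose u N := N%:R * ln k%:R - holevo (tpow Phi N).
have u_cvg : cvgn (fun N => u N.+1 / N.+1%:R).
  apply: fekete => [N|M N]; rewrite /u.
    rewrite subr_ge0 (le_trans (holevo_le_Smin N)) // gerBl; exact: Smin_ge0.
  rewrite addrACA -opprD lerB ?holevo_superadd // natrD mulrDl addrC.
  exact: lexx.
have -> : (fun N => holevo (tpow Phi N.+1) / N.+1%:R) =
    (fun N => ln k%:R - u N.+1 / N.+1%:R).
  apply/funext => N; rewrite /u mulrBl mulrAC divff ?pnatr_eq0 //.
  by rewrite mul1r opprB addrC subrK.
apply: is_cvgB => //; exact: is_cvg_cst.
Qed.

End Capacity.

Unset Implicit Arguments.

Theorem theorem1 (R : realType) (n k : nat)
  (Phi : 'M[R[i]]_n -> 'M[R[i]]_k) (M : 'I_(n ^ 2 - 1) -> 'M[R[i]]_n) :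
  (0 < n)%N -> (0 < k)%N ->
  is_channel Phi -> unital Phi -> onb_traceless M ->
  let g := gammaQ n k (lmax (Amat Phi M)) in
  (cvgn (fun N : nat => Smin (tpow Phi N.+1) / (N.+1)%:R) /\
   - ln g <= limn (fun N : nat => Smin (tpow Phi N.+1) / (N.+1)%:R)) /\
  (cvgn (fun N : nat => holevo (tpow Phi N.+1) / (N.+1)%:R) /\
   capacity Phi <= ln (k%:R) + ln g).
Proof.
move=> n_gt0 k_gt0 Phi_channel Phi_unital M_onb g.
have g_gt0 : 0 < g by apply: gammaQ_gt0.
have N_gt0 N : 0 < N.+1%:R :> R by rewrite ltr0n.
(* Every output of the tensor power has purity at most [g ^+ N.+1]; both limits inherit their bounds
   from this one termwise. *)
have Smin_g N : N.+1%:R * - ln g <= Smin (tpow Phi N.+1).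
  apply: Smin_ge => // rho rho_dens.
  rewrite mulrN mulr_natl -lnXn //; apply: entropy_ge_purity.
    exact: tpow_density.
  exact: hs_tpow_le.
have Scvg := Smin_rate_cvg n_gt0 Phi_channel.
have Hcvg := holevo_rate_cvg n_gt0 k_gt0 Phi_channel.
split; split=> //.
  apply: limr_ge => //; apply: nearW => N.
  by rewrite ler_pdivlMr // mulrC.
apply: limr_le => //; apply: nearW => N.
rewrite ler_pdivrMr // (le_trans (holevo_le_Smin _ _ _ N.+1)) //.
by rewrite mulrDl ![_ * N.+1%:R]mulrC lerD2l lerNl -mulrN.
Qed.
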